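(* Let $P$ be an MAV structure. If for every MAV-frame $F=(F,\le,⅋,\lhd,i,+)$ and every valuation $V$ of the atoms in $\mathrm{Chu}(F)$, the interpretation satisfies $I\sqsubseteq[\![P]\!]$ in $\mathrm{Chu}(F)$, then $P\longrightarrow^*\mathbf 1$ in MAV.
   Context: MAV syntax: structures $P ::= a \mid a^\perp \mid \mathbf{1} \mid P;Q \mid P\otimes Q \mid P⅋Q \mid P\& Q \mid P\oplus Q$ over a set of atoms, with duality $(a)^\perp=a^\perp$, $(a^\perp)^\perp=a$, $\mathbf 1^\perp=\mathbf 1$, $(P\otimes Q)^\perp=P^\perp⅋Q^\perp$, $(P⅋Q)^\perp=P^\perp\otimes Q^\perp$, $(P;Q)^\perp=P^\perp;Q^\perp$, $(P\&Q)^\perp=P^\perp\oplus Q^\perp$, $(P\oplus Q)^\perp=P^\perp\&Q^\perp$; structures taken modulo the congruence making $(;,\mathbf 1)$ a monoid and $(\otimes,\mathbf 1),(⅋,\mathbf 1)$ commutative monoids. $P\longrightarrow Q$ is the least context-closed relation containing: $P⅋P^\perp\to\mathbf 1$; $(P\otimes Q)⅋R\to P\otimes(Q⅋R)$; $\mathbf 1\&\mathbf 1\to\mathbf 1$; $(P;Q)⅋(R;S)\to(P⅋R);(Q⅋S)$; $P\oplus Q\to P$; $P\oplus Q\to Q$; $(P\&Q)⅋R\to(P⅋R)\&(Q⅋R)$; $(P;Q)\&(R;S)\to(P\&R);(Q\&S)$; $\mathbf 1\to P\otimes P^\perp$; $\mathbf 1\to\mathbf 1\oplus\mathbf 1$;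 $(P\otimes R);(Q\otimes S)\to(P;Q)\otimes(R;S)$; $P\to P\&Q$; $Q\to P\&Q$; $(P\otimes R)\oplus(Q\otimes R)\to(P\oplus Q)\otimes R$; $(P\oplus R);(Q\oplus S)\to(P;Q)\oplus(R;S)$. $\longrightarrow^*$ is its reflexive–transitive closure. An MAV-frame is $(F,\le,⅋,\lhd,i,+)$ with $(F,\le)$ a poset, $(⅋,i)$ a commutative monoid with $⅋$ monotone, $(\lhd,i)$ a monoid with $\lhd$ monotone, $+$ a monotone binary operation, such that $(w\lhd x)⅋(y\lhd z)\le(w⅋y)\lhd(x⅋z)$, $(x+y)⅋z\le(x⅋z)+(y⅋z)$, $(w\lhd x)+(y\lhd z)\le(w+y)\lhd(x+z)$, and $i+i\le i$. Construction $\mathrm{Chu}(F)$: a lower set is a down-closed $X\subseteq F$; $\eta(x)=\{y\mid y\le x\}$. For a lower set $X$, $\alpha(X)=\{x\mid x\le s$ for some $s$ that is a finite $+$-combination (any binary tree of $+$) of elements of $X\}$. Let $\mathcal C(F)$ be the lower sets closed under $+$, ordered by $\subseteq$; it has meets $\cap$ and joins $X\vee Y=\alpha(X\cup Y)$. Put $K=\eta(i)$, $X\circledast Y=\alpha(\{z\mid z\le x⅋y, x\in X,y\in Y\})$, $X\,\hat\lhd\, Y=\{z\mid z\le x\lhd y,x\in X,y\in Y\}$, $X\multimap Y=\{z\mid \forall x\in X,\ z⅋x\in Y\}$. $\mathrm{Chu}(F)$ consists of pairs $(X^+,X^-)$ of elements of $\mathcal C(F)$ with $X^+\circledast X^-\subseteq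 K$, ordered by $(X^+,X^-)\sqsubseteq(Y^+,Y^-)$ iff $X^+\subseteq Y^+$ and $Y^-\subseteq X^-$, with $X\otimes Y=(X^+\circledast Y^+,(Y^+\multimap X^-)\cap(X^+\multimap Y^-))$, $I=(K,K)$, $\neg(X^+,X^-)=(X^-,X^+)$, $X\lhd Y=(X^+\hat\lhd Y^+,X^-\hat\lhd Y^-)$, $X\&Y=(X^+\cap Y^+,X^-\vee Y^-)$. Given a valuation $V$ from atoms to $\mathrm{Chu}(F)$, the interpretation is $[\![\mathbf 1]\!]=I$, $[\![a]\!]=V(a)$, $[\![a^\perp]\!]=\neg V(a)$, $[\![P\otimes Q]\!]=[\![P]\!]\otimes[\![Q]\!]$, $[\![P⅋Q]\!]=\neg(\neg[\![P]\!]\otimes\neg[\![Q]\!])$, $[\![P;Q]\!]=[\![P]\!]\lhd[\![Q]\!]$, $[\![P\&Q]\!]=[\![P]\!]\&[\![Q]\!]$, $[\![P\oplus Q]\!]=\neg(\neg[\![P]\!]\&\neg[\![Q]\!])$. *)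

(* Defs.v *)
From Stdlib Require Import Relations Ensembles.

Set Implicit Arguments.
Unset Strict Implicit.
Unset Printing Implicit Defensive.

Arguments In {U} A x.
Arguments Included {U} B C.
Arguments Intersection {U} B C.
Arguments Union {U} B C.

Declare Scope mav_scope.
Declare Scope frame_scope.
Delimit Scope mav_scope with mav.
Delimit Scope frame_scope with frame.

Reserved Notation "P ⊗ Q" (at level 40, left associativity).
Reserved Notation "P ⅋ Q" (at level 40, left associativity).
Reserved Notation "P ;; Q" (at level 40, left associativity).
Reserved Notation "P ⊕ Q" (at level 40, left associativity).
Reserved Notation "x ◁ y" (at level 40, left associativity).
Reserved Notation "P ^⊥" (at level 1, left associativity, format "P ^⊥").
Reserved Notation "P ≡ Q" (at level 70, no associativity).
Reserved Notation "P ⟶ Q" (at level 70, no associativity).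
Reserved Notation "x ≤ y" (at level 70, no associativity).
Reserved Notation "x ∈ X" (at level 70, no associativity).
Reserved Notation "X ⊆ Y" (at level 70, no associativity).

(** * MAV structures and rewriting *)

(** Raw terms; the quotient by the congruence is represented by [cong] below. *)
Inductive structure (A : Type) : Type :=
| Atom (a : A)
| CoAtom (a : A)
| One
| Seq (P Q : structure A)
| Tensor (P Q : structure A)
| Par (P Q : structure A)
| With (P Q : structure A)
| Plus (P Q : structure A).

Arguments One {A}.
Bind Scope mav_scope with structure.

Notation "'𝟏'" := One : mav_scope.
Notation "P ;; Q" := (Seq P Q) : mav_scope.
Notation "P ⊗ Q" := (Tensor P Q) : mav_scope.
Notation "P ⅋ Q" := (Par P Q) : mav_scope.
Notation "P && Q" := (With P Q) : mav_scope.
Notation "P ⊕ Q" := (Plus P Q) : mav_scope.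

Fixpoint dual (A : Type) (P : structure A) : structure A :=
  (match P with
   | Atom a => CoAtom a
   | CoAtom a => Atom a
   | 𝟏 => 𝟏
   | P ;; Q => dual P ;; dual Q
   | P ⊗ Q => dual P ⅋ dual Q
   | P ⅋ Q => dual P ⊗ dual Q
   | P && Q => dual P ⊕ dual Q
   | P ⊕ Q => dual P && dual Q
   end)%mav.

Notation "P ^⊥" := (dual P) : mav_scope.

Inductive cong (A : Type) : relation (structure A) :=
| cong_refl P : P ≡ P
| cong_sym P Q : P ≡ Q -> Q ≡ P
| cong_trans P Q R : P ≡ Q -> Q ≡ R -> P ≡ R
| cong_seq P P' Q Q' : P ≡ P' -> Q ≡ Q' -> P ;; Q ≡ P' ;; Q'
| cong_tensor P P' Q Q' : P ≡ P' -> Q ≡ Q' -> P ⊗ Q ≡ P' ⊗ Q'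
| cong_par P P' Q Q' : P ≡ P' -> Q ≡ Q' -> P ⅋ Q ≡ P' ⅋ Q'
| cong_with P P' Q Q' : P ≡ P' -> Q ≡ Q' -> P && Q ≡ P' && Q'
| cong_plus P P' Q Q' : P ≡ P' -> Q ≡ Q' -> P ⊕ Q ≡ P' ⊕ Q'
| seq_monoid_assoc P Q R : (P ;; Q) ;; R ≡ P ;; (Q ;; R)
| seq_monoid_unit_l P : 𝟏 ;; P ≡ P
| seq_monoid_unit_r P : P ;; 𝟏 ≡ P
| tensor_monoid_assoc P Q R : (P ⊗ Q) ⊗ R ≡ P ⊗ (Q ⊗ R)
| tensor_monoid_comm P Q : P ⊗ Q ≡ Q ⊗ P
| tensor_monoid_unit P : 𝟏 ⊗ P ≡ P
| par_monoid_assoc P Q R : (P ⅋ Q) ⅋ R ≡ P ⅋ (Q ⅋ R)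
| par_monoid_comm P Q : P ⅋ Q ≡ Q ⅋ P
| par_monoid_unit P : 𝟏 ⅋ P ≡ P
where "P ≡ Q" := (cong P%mav Q%mav) : type_scope.

(** [step] is a relation on congruence classes, given on representatives:
    [step_cong] saturates it under [cong]. *)
Inductive step (A : Type) : relation (structure A) :=
| step_axiom P : P ⅋ P^⊥ ⟶ 𝟏
| step_switch P Q R : (P ⊗ Q) ⅋ R ⟶ P ⊗ (Q ⅋ R)
| step_tidy : 𝟏 && 𝟏 ⟶ 𝟏
| step_sequence P Q R S : (P ;; Q) ⅋ (R ;; S) ⟶ (P ⅋ R) ;; (Q ⅋ S)
| step_left P Q : P ⊕ Q ⟶ P
| step_right P Q : P ⊕ Q ⟶ Q
| step_external P Q R : (P && Q) ⅋ R ⟶ (P ⅋ R) && (Q ⅋ R)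
| step_medial P Q R S : (P ;; Q) && (R ;; S) ⟶ (P && R) ;; (Q && S)
| step_cut P : 𝟏 ⟶ P ⊗ P^⊥
| step_cotidy : 𝟏 ⟶ 𝟏 ⊕ 𝟏
| step_cosequence P Q R S : (P ⊗ R) ;; (Q ⊗ S) ⟶ (P ;; Q) ⊗ (R ;; S)
| step_coleft P Q : P ⟶ P && Q
| step_coright P Q : Q ⟶ P && Q
| step_coexternal P Q R : (P ⊗ R) ⊕ (Q ⊗ R) ⟶ (P ⊕ Q) ⊗ R
| step_comedial P Q R S : (P ⊕ R) ;; (Q ⊕ S) ⟶ (P ;; Q) ⊕ (R ;; S)
| step_seq_l P P' Q : P ⟶ P' -> P ;; Q ⟶ P' ;; Q
| step_seq_r P Q Q' : Q ⟶ Q' -> P ;; Q ⟶ P ;; Q'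
| step_tensor_l P P' Q : P ⟶ P' -> P ⊗ Q ⟶ P' ⊗ Q
| step_tensor_r P Q Q' : Q ⟶ Q' -> P ⊗ Q ⟶ P ⊗ Q'
| step_par_l P P' Q : P ⟶ P' -> P ⅋ Q ⟶ P' ⅋ Q
| step_par_r P Q Q' : Q ⟶ Q' -> P ⅋ Q ⟶ P ⅋ Q'
| step_with_l P P' Q : P ⟶ P' -> P && Q ⟶ P' && Q
| step_with_r P Q Q' : Q ⟶ Q' -> P && Q ⟶ P && Q'
| step_plus_l P P' Q : P ⟶ P' -> P ⊕ Q ⟶ P' ⊕ Q
| step_plus_r P Q Q' : Q ⟶ Q' -> P ⊕ Q ⟶ P ⊕ Q'
| step_cong P P' Q Q' : P ≡ P' -> P' ⟶ Q' -> Q' ≡ Q -> P ⟶ Q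
where "P ⟶ Q" := (step P%mav Q%mav) : type_scope.

(** Reflexivity is up to [cong], since congruent terms are the same structure. *)
Definition steps (A : Type) : relation (structure A) :=
  clos_refl_trans (structure A) (union (structure A) (@cong A) (@step A)).

(** * MAV-frames *)

Record mav_frame : Type := {
  carrier :> Type;
  fle : relation carrier;
  fpar : carrier -> carrier -> carrier;
  fseq : carrier -> carrier -> carrier;
  fi : carrier;
  fplus : carrier -> carrier -> carrier;

  fle_order : order carrier fle;

  fpar_assoc x y z : fpar (fpar x y) z = fpar x (fpar y z);
  fpar_comm x y : fpar x y = fpar y x;
  fpar_unit x : fpar fi x = x;
  fpar_mono x x' y y' : fle x x' -> fle y y' -> fle (fpar x y) (fpar x' y');

  fseq_assoc x y z : fseq (fseq x y) z = fseq x (fseq y z);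
  fseq_unit_l x : fseq fi x = x;
  fseq_unit_r x : fseq x fi = x;
  fseq_mono x x' y y' : fle x x' -> fle y y' -> fle (fseq x y) (fseq x' y');

  fplus_mono x x' y y' : fle x x' -> fle y y' -> fle (fplus x y) (fplus x' y');

  fpar_fseq w x y z :
    fle (fpar (fseq w x) (fseq y z)) (fseq (fpar w y) (fpar x z));
  fpar_fplus x y z : fle (fpar (fplus x y) z) (fplus (fpar x z) (fpar y z));
  fseq_fplus w x y z :
    fle (fplus (fseq w x) (fseq y z)) (fseq (fplus w y) (fplus x z));
  fplus_fi : fle (fplus fi fi) fi
}.

Bind Scope frame_scope with carrier.
Notation "x ≤ y" := (fle x%frame y%frame) : type_scope.
Notation "x ⅋ y" := (fpar x y) : frame_scope.
Notation "x ◁ y" := (fseq x y) : frame_scope.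
Notation "x + y" := (fplus x y) : frame_scope.
Notation "x ∈ X" := (In X x%frame) : type_scope.
Notation "X ⊆ Y" := (Included X Y) : type_scope.

Lemma fle_refl (F : mav_frame) (x : F) : x ≤ x.
Proof. exact (ord_refl _ _ (fle_order F) x). Qed.

Lemma fle_trans (F : mav_frame) (x y z : F) : x ≤ y -> y ≤ z -> x ≤ z.
Proof. exact (ord_trans _ _ (fle_order F) x y z). Qed.

(** * Lower sets closed under [+] *)

Record closed_set (F : mav_frame) : Type := {
  elements :> Ensemble F;
  closed_lower x y : x ≤ y -> y ∈ elements -> x ∈ elements;
  closed_plus x y : x ∈ elements -> y ∈ elements -> x + y ∈ elements
}.

(** Nonempty finite [+]-combinations, bracketed arbitrarily. *)
Inductive combination (F : mav_frame) (X : Ensemble F) : Ensemble F :=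
| comb_leaf x : x ∈ X -> x ∈ combination X
| comb_node s t : s ∈ combination X -> t ∈ combination X -> s + t ∈ combination X.

Definition alpha_set (F : mav_frame) (X : Ensemble F) : Ensemble F :=
  fun x => exists s, s ∈ combination X /\ x ≤ s.

Lemma alpha_lower (F : mav_frame) (X : Ensemble F) x y :
  x ≤ y -> y ∈ alpha_set X -> x ∈ alpha_set X.
Proof.
  intros Hxy [s [Hs Hys]]. exists s. split; [exact Hs | exact (fle_trans Hxy Hys)].
Qed.

Lemma alpha_plus (F : mav_frame) (X : Ensemble F) x y :
  x ∈ alpha_set X -> y ∈ alpha_set X -> x + y ∈ alpha_set X.
Proof.
  intros [s [Hs Hxs]] [t [Ht Hyt]]. exists (s + t)%frame.
  split; [now apply comb_node | now apply fplus_mono].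
Qed.

Definition alpha (F : mav_frame) (X : Ensemble F) : closed_set F :=
  {| elements := alpha_set X;
     closed_lower := @alpha_lower F X;
     closed_plus := @alpha_plus F X |}.

Lemma alpha_least (F : mav_frame) (X : Ensemble F) (Y : closed_set F) :
  X ⊆ Y -> alpha X ⊆ Y.
Proof.
  intros HXY x [s [Hs Hxs]]. apply (closed_lower Hxs). clear x Hxs.
  induction Hs as [x Hx | s t _ IHs _ IHt]; [now apply HXY | now apply closed_plus].
Qed.

Definition eta (F : mav_frame) (x : F) : Ensemble F := fun y => y ≤ x.

Lemma K_lower (F : mav_frame) (x y : F) : x ≤ y -> y ∈ eta (fi F) -> x ∈ eta (fi F).
Proof. exact (@fle_trans F x y (fi F)). Qed.

Lemma K_plus (F : mav_frame) (x y : F) :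
  x ∈ eta (fi F) -> y ∈ eta (fi F) -> x + y ∈ eta (fi F).
Proof.
  intros Hx Hy. exact (fle_trans (fplus_mono Hx Hy) (fplus_fi F)).
Qed.

Definition K (F : mav_frame) : closed_set F :=
  {| elements := eta (fi F); closed_lower := @K_lower F; closed_plus := @K_plus F |}.

Lemma meet_lower (F : mav_frame) (X Y : closed_set F) x y :
  x ≤ y -> y ∈ Intersection X Y -> x ∈ Intersection X Y.
Proof.
  intros Hxy Hy. destruct Hy as [y HX HY].
  split; [exact (closed_lower Hxy HX) | exact (closed_lower Hxy HY)].
Qed.

Lemma meet_plus (F : mav_frame) (X Y : closed_set F) x y :
  x ∈ Intersection X Y -> y ∈ Intersection X Y -> x + y ∈ Intersection X Y.
Proof.
  intros Hx Hy. destruct Hx as [x HX HY], Hy as [y HX' HY'].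
  split; now apply closed_plus.
Qed.

Definition meet (F : mav_frame) (X Y : closed_set F) : closed_set F :=
  {| elements := Intersection X Y;
     closed_lower := @meet_lower F X Y;
     closed_plus := @meet_plus F X Y |}.

Definition join (F : mav_frame) (X Y : closed_set F) : closed_set F :=
  alpha (Union X Y).

Definition conv (F : mav_frame) (X Y : closed_set F) : closed_set F :=
  alpha (fun z => exists x y, x ∈ X /\ y ∈ Y /\ z ≤ x ⅋ y).

Definition hseq_set (F : mav_frame) (X Y : closed_set F) : Ensemble F :=
  fun z => exists x y, x ∈ X /\ y ∈ Y /\ z ≤ x ◁ y.

Lemma hseq_lower (F : mav_frame) (X Y : closed_set F) x y :
  x ≤ y -> y ∈ hseq_set X Y -> x ∈ hseq_set X Y.
Proof.
  intros Hxy [u [v [Hu [Hv H]]]]. exists u, v.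
  repeat split; [exact Hu | exact Hv | exact (fle_trans Hxy H)].
Qed.

Lemma hseq_plus (F : mav_frame) (X Y : closed_set F) x y :
  x ∈ hseq_set X Y -> y ∈ hseq_set X Y -> x + y ∈ hseq_set X Y.
Proof.
  intros [u [v [Hu [Hv H]]]] [u' [v' [Hu' [Hv' H']]]].
  exists (u + u')%frame, (v + v')%frame.
  repeat split; [now apply closed_plus | now apply closed_plus |].
  exact (fle_trans (fplus_mono H H') (fseq_fplus u v u' v')).
Qed.

Definition hseq (F : mav_frame) (X Y : closed_set F) : closed_set F :=
  {| elements := hseq_set X Y;
     closed_lower := @hseq_lower F X Y;
     closed_plus := @hseq_plus F X Y |}.

Definition lolli_set (F : mav_frame) (X Y : closed_set F) : Ensemble F :=
  fun z => forall x, x ∈ X -> z ⅋ x ∈ Y.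

Lemma lolli_lower (F : mav_frame) (X Y : closed_set F) x y :
  x ≤ y -> y ∈ lolli_set X Y -> x ∈ lolli_set X Y.
Proof.
  intros Hxy H z Hz. apply (closed_lower (fpar_mono Hxy (fle_refl z))). now apply H.
Qed.

Lemma lolli_plus (F : mav_frame) (X Y : closed_set F) x y :
  x ∈ lolli_set X Y -> y ∈ lolli_set X Y -> x + y ∈ lolli_set X Y.
Proof.
  intros Hx Hy z Hz. apply (closed_lower (fpar_fplus x y z)).
  apply closed_plus; [now apply Hx | now apply Hy].
Qed.

Definition lolli (F : mav_frame) (X Y : closed_set F) : closed_set F :=
  {| elements := lolli_set X Y;
     closed_lower := @lolli_lower F X Y;
     closed_plus := @lolli_plus F X Y |}.

Lemma conv_sub (F : mav_frame) (X Y Z : closed_set F) :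
  conv X Y ⊆ Z <-> forall x y, x ∈ X -> y ∈ Y -> x ⅋ y ∈ Z.
Proof.
  split.
  - intros H x y Hx Hy. apply H. exists (x ⅋ y)%frame. split; [|apply fle_refl].
    apply comb_leaf. exists x, y. repeat split; auto using fle_refl.
  - intros H. apply alpha_least. intros z [x [y [Hx [Hy Hz]]]].
    exact (closed_lower Hz (H x y Hx Hy)).
Qed.

Lemma alpha_K (F : mav_frame) (X : Ensemble F) (Y : closed_set F) :
  (forall x y, x ∈ X -> y ∈ Y -> x ⅋ y ∈ K F) ->
  forall x y, x ∈ alpha X -> y ∈ Y -> x ⅋ y ∈ K F.
Proof.
  intros H x y Hx Hy. revert x Hx y Hy.
  change (alpha X ⊆ lolli Y (K F)). apply alpha_least.
  intros x Hx y Hy. now apply H.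
Qed.

(** * The Chu construction *)

Record chu (F : mav_frame) : Type := {
  pos : closed_set F;
  neg : closed_set F;
  chu_orth : conv pos neg ⊆ K F
}.

Definition chu_le (F : mav_frame) (X Y : chu F) : Prop :=
  pos X ⊆ pos Y /\ neg Y ⊆ neg X.

Lemma chu_par (F : mav_frame) (X : chu F) x y :
  x ∈ pos X -> y ∈ neg X -> x ⅋ y ≤ fi F.
Proof. exact (proj1 (conv_sub (pos X) (neg X) (K F)) (@chu_orth F X) x y). Qed.

Lemma chu_I_orth (F : mav_frame) : conv (K F) (K F) ⊆ K F.
Proof.
  apply conv_sub. intros x y Hx Hy. apply (fle_trans (fpar_mono Hx Hy)).
  rewrite fpar_unit. apply fle_refl.
Qed.

Definition chu_I (F : mav_frame) : chu F :=
  {| pos := K F; neg := K F; chu_orth := @chu_I_orth F |}.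

Lemma chu_neg_orth (F : mav_frame) (X : chu F) : conv (neg X) (pos X) ⊆ K F.
Proof.
  apply conv_sub. intros x y Hx Hy. rewrite fpar_comm. now apply (chu_par (X := X)).
Qed.

Definition chu_neg (F : mav_frame) (X : chu F) : chu F :=
  {| pos := neg X; neg := pos X; chu_orth := @chu_neg_orth F X |}.

Lemma chu_tensor_orth (F : mav_frame) (X Y : chu F) :
  conv (conv (pos X) (pos Y))
       (meet (lolli (pos Y) (neg X)) (lolli (pos X) (neg Y))) ⊆ K F.
Proof.
  apply conv_sub. apply alpha_K. intros u z [x [y [Hx [Hy Hu]]]] Hz.
  destruct Hz as [z Hz _].
  apply (closed_lower (fpar_mono Hu (fle_refl z))).
  rewrite fpar_assoc, (fpar_comm y z). apply (chu_par Hx). now apply Hz.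
Qed.

Definition chu_tensor (F : mav_frame) (X Y : chu F) : chu F :=
  {| pos := conv (pos X) (pos Y);
     neg := meet (lolli (pos Y) (neg X)) (lolli (pos X) (neg Y));
     chu_orth := @chu_tensor_orth F X Y |}.

Lemma chu_seq_orth (F : mav_frame) (X Y : chu F) :
  conv (hseq (pos X) (pos Y)) (hseq (neg X) (neg Y)) ⊆ K F.
Proof.
  apply conv_sub. intros u v [x [y [Hx [Hy Hu]]]] [x' [y' [Hx' [Hy' Hv]]]].
  apply (fle_trans (fpar_mono Hu Hv)).
  apply (fle_trans (fpar_fseq x y x' y')).
  apply (fle_trans (fseq_mono (chu_par Hx Hx') (chu_par Hy Hy'))).
  rewrite fseq_unit_l. apply fle_refl.
Qed.

Definition chu_seq (F : mav_frame) (X Y : chu F) : chu F :=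
  {| pos := hseq (pos X) (pos Y);
     neg := hseq (neg X) (neg Y);
     chu_orth := @chu_seq_orth F X Y |}.

Lemma chu_with_orth (F : mav_frame) (X Y : chu F) :
  conv (meet (pos X) (pos Y)) (join (neg X) (neg Y)) ⊆ K F.
Proof.
  apply conv_sub. intros u v Hu Hv. rewrite fpar_comm. revert v u Hv Hu.
  apply alpha_K. intros v u Hv Hu. destruct Hu as [u HX HY].
  rewrite fpar_comm.
  destruct Hv as [v Hv | v Hv]; [exact (chu_par HX Hv) | exact (chu_par HY Hv)].
Qed.

Definition chu_with (F : mav_frame) (X Y : chu F) : chu F :=
  {| pos := meet (pos X) (pos Y);
     neg := join (neg X) (neg Y);
     chu_orth := @chu_with_orth F X Y |}.

Fixpoint interp (A : Type) (F : mav_frame) (V : A -> chu F) (P : structure A) : chu F :=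
  (match P with
   | Atom a => V a
   | CoAtom a => chu_neg (V a)
   | 𝟏 => chu_I F
   | P ;; Q => chu_seq (interp V P) (interp V Q)
   | P ⊗ Q => chu_tensor (interp V P) (interp V Q)
   | P ⅋ Q => chu_neg (chu_tensor (chu_neg (interp V P)) (chu_neg (interp V Q)))
   | P && Q => chu_with (interp V P) (interp V Q)
   | P ⊕ Q => chu_neg (chu_with (chu_neg (interp V P)) (chu_neg (interp V Q)))
   end)%mav.

(* Main.v *)
(** Take as frame the sets of structures closed under backward rewriting,
    ordered by inclusion, with [+] induced by [&].  Interpreting [a] by the pair
    (↓[a^⊥], ↓[a]), one finds ↓P in the negative part and ↓[P^⊥] in the positive
    part of [[P]], for every P.  The inequality I ⊑ [[P]] puts the negative part
    of [[P]] inside K, so that ↓P ⊆ ↓[1], i.e. P rewrites to [1]. *)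

From Stdlib Require Import Relations Ensembles.
From Stdlib Require Import FunctionalExtensionality PropExtensionality ProofIrrelevance.
Require Import Defs.

Set Implicit Arguments.
Unset Strict Implicit.

Notation "P ⟶* Q" := (steps P%mav Q%mav) (at level 70, no associativity) : type_scope.

(** * Compatibility of rewriting with congruence and the connectives *)

Section Rewriting.

Variable A : Type.
Implicit Types P Q R S : structure A.

Lemma steps_refl P : P ⟶* P.
Proof. apply rt_refl. Qed.

Lemma steps_trans P Q R : P ⟶* Q -> Q ⟶* R -> P ⟶* R.
Proof. apply rt_trans. Qed.

Lemma cong_steps P Q : P ≡ Q -> P ⟶* Q.
Proof. intros H. apply rt_step. now left. Qed.

Lemma step_steps P Q : P ⟶ Q -> P ⟶* Q.
Proof. intros H. apply rt_step. now right. Qed.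

Lemma steps_map (f : structure A -> structure A) :
  (forall P Q, P ≡ Q -> f P ≡ f Q) ->
  (forall P Q, P ⟶ Q -> f P ⟶ f Q) ->
  forall P Q, P ⟶* Q -> f P ⟶* f Q.
Proof.
  intros Hcong Hstep P Q H.
  induction H as [P Q [H | H] | P | P Q R _ IH1 _ IH2].
  - now apply cong_steps, Hcong.
  - now apply step_steps, Hstep.
  - apply steps_refl.
  - exact (steps_trans IH1 IH2).
Qed.

Definition steps_mono (op : structure A -> structure A -> structure A) : Prop :=
  forall P P' Q Q', P ⟶* P' -> Q ⟶* Q' -> op P Q ⟶* op P' Q'.

Lemma steps_mono_of_cong_step op :
  (forall P P' Q Q', P ≡ P' -> Q ≡ Q' -> op P Q ≡ op P' Q') ->
  (forall P P' Q, P ⟶ P' -> op P Q ⟶ op P' Q) ->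
  (forall P Q Q', Q ⟶ Q' -> op P Q ⟶ op P Q') ->
  steps_mono op.
Proof.
  intros Hcong Hl Hr P P' Q Q' HP HQ. apply (@steps_trans _ (op P' Q)).
  - apply (@steps_map (fun R => op R Q)); auto using cong_refl.
  - apply (@steps_map (op P')); auto using cong_refl.
Qed.

Lemma steps_seq : steps_mono (@Seq A).
Proof. exact (steps_mono_of_cong_step (@cong_seq A) (@step_seq_l A) (@step_seq_r A)). Qed.

Lemma steps_tensor : steps_mono (@Tensor A).
Proof.
  exact (steps_mono_of_cong_step (@cong_tensor A) (@step_tensor_l A) (@step_tensor_r A)).
Qed.

Lemma steps_par : steps_mono (@Par A).
Proof. exact (steps_mono_of_cong_step (@cong_par A) (@step_par_l A) (@step_par_r A)). Qed.

Lemma steps_with : steps_mono (@With A).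
Proof. exact (steps_mono_of_cong_step (@cong_with A) (@step_with_l A) (@step_with_r A)). Qed.

(** Switch brings [R] next to [Q], where the two rewrite to the unit. This is what later places a
    tensor inside a linear implication. *)
Lemma steps_tensor_par P Q R : Q ⅋ R ⟶* 𝟏 -> (P ⊗ Q) ⅋ R ⟶* P.
Proof.
  intros H. apply (steps_trans (step_steps (step_switch P Q R))).
  apply (steps_trans (steps_tensor (steps_refl P) H)).
  apply cong_steps.
  exact (cong_trans (tensor_monoid_comm P One) (tensor_monoid_unit P)).
Qed.

Lemma steps_tensor_par_l P Q R : P ⅋ R ⟶* 𝟏 -> (P ⊗ Q) ⅋ R ⟶* Q.
Proof.
  intros H. apply (@steps_trans _ ((Q ⊗ P) ⅋ R)).
  - apply cong_steps, cong_par; [apply tensor_monoid_comm | apply cong_refl].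
  - now apply steps_tensor_par.
Qed.

End Rewriting.

(** * Par-products with [+]-closures *)

Lemma alpha_par (F : mav_frame) (X Y : Ensemble F) (Z : closed_set F) :
  (forall x y, x ∈ X -> y ∈ Y -> x ⅋ y ∈ Z) ->
  forall x y, x ∈ alpha X -> y ∈ Y -> x ⅋ y ∈ Z.
Proof.
  intros H x y [s [Hs Hxs]] Hy. apply (closed_lower (fpar_mono Hxs (fle_refl y))).
  (* By [fpar_fplus], [y] distributes over a combination, so induction reduces the claim to its
     leaves. *)
  clear x Hxs. induction Hs as [x Hx | s t _ IHs _ IHt]; [now apply H|].
  exact (closed_lower (fpar_fplus s t y) (closed_plus IHs IHt)).
Qed.

(** The one-sided extension is applied to each argument in turn, with commutativity exchanging
    them. *)
Lemma alpha_par_alpha (F : mav_frame) (X Y : Ensemble F) (Z : closed_set F) :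
  (forall x y, x ∈ X -> y ∈ Y -> x ⅋ y ∈ Z) ->
  forall x y, x ∈ alpha X -> y ∈ alpha Y -> x ⅋ y ∈ Z.
Proof.
  intros H. apply alpha_par. intros x y Hx Hy. rewrite fpar_comm.
  revert Hy Hx. apply alpha_par. intros y' x' Hy Hx. rewrite fpar_comm. now apply H.
Qed.

(** * The poset of sets closed under backward rewriting *)

Section SyntacticFrame.

Variable A : Type.

(** Frame laws are equations, while structures satisfy them only up to [≡]. Since [⟶*] contains [≡],
    such sets absorb congruence and the monoid laws become true equalities. *)
Definition downset : Type :=
  { X : Ensemble (structure A) | forall P Q, P ⟶* Q -> In X Q -> In X P }.

Definition members (X : downset) : Ensemble (structure A) := proj1_sig X.

Lemma members_down (X : downset) P Q : P ⟶* Q -> In (members X) Q -> In (members X) P.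
Proof. exact (proj2_sig X P Q). Qed.

Definition downset_le (X Y : downset) : Prop := members X ⊆ members Y.

Lemma downset_le_antisym X Y : downset_le X Y -> downset_le Y X -> X = Y.
Proof.
  (* Equality of the underlying sets suffices, closure proofs being identified by proof
     irrelevance. *)
  destruct X as [X HX], Y as [Y HY]. intros HXY HYX. apply subset_eq_compat.
  extensionality P. apply propositional_extensionality.
  split; [apply HXY | apply HYX].
Qed.

Lemma downset_le_order : order downset downset_le.
Proof.
  split.
  - intros X P HP. exact HP.
  - intros X Y Z HXY HYZ P HP. now apply HYZ, HXY.
  - exact downset_le_antisym.
Qed.

(** * Principal downsets and lifted connectives *)

Definition principal_set (P : structure A) : Ensemble (structure A) :=
  fun Q => Q ⟶* P.

Lemma principal_down R P Q :
  P ⟶* Q -> In (principal_set R) Q -> In (principal_set R) P.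
Proof. exact (@steps_trans A P Q R). Qed.

Definition principal (P : structure A) : downset :=
  exist _ (principal_set P) (@principal_down P).

(** Day-style extension of [op]: the least downset containing every [op P Q] with [P] in [X] and [Q]
    in [Y]. *)
Definition lift_set (op : structure A -> structure A -> structure A)
    (X Y : downset) : Ensemble (structure A) :=
  fun R => exists P Q, In (members X) P /\ In (members Y) Q /\ R ⟶* op P Q.

Lemma lift_down op X Y P Q :
  P ⟶* Q -> In (lift_set op X Y) Q -> In (lift_set op X Y) P.
Proof.
  intros H [R [S [HR [HS HQ]]]]. exists R, S.
  repeat split; [assumption .. | exact (steps_trans H HQ)].
Qed.

Definition lift (op : structure A -> structure A -> structure A) (X Y : downset) :
  downset := exist _ (lift_set op X Y) (@lift_down op X Y).

Lemma in_lift op (X Y : downset) P Q :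
  In (members X) P -> In (members Y) Q -> In (members (lift op X Y)) (op P Q).
Proof. intros HP HQ. exists P, Q. auto using steps_refl. Qed.

(** As [Z] is already a downset, an inclusion out of a lift is checked on generators only. *)
Lemma lift_sub op X Y Z :
  (forall P Q, In (members X) P -> In (members Y) Q -> In (members Z) (op P Q)) ->
  downset_le (lift op X Y) Z.
Proof.
  intros H R [P [Q [HP [HQ HR]]]]. apply (members_down HR). now apply H.
Qed.

Lemma lift_mono op X X' Y Y' :
  downset_le X X' -> downset_le Y Y' -> downset_le (lift op X Y) (lift op X' Y').
Proof.
  intros HX HY. apply lift_sub. intros P Q HP HQ.
  apply in_lift; [now apply HX | now apply HY].
Qed.

Lemma lift_assoc op : steps_mono op ->
  (forall P Q R, op (op P Q) R ≡ op P (op Q R)) ->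
  forall X Y Z, lift op (lift op X Y) Z = lift op X (lift op Y Z).
Proof.
  intros Hmono Hassoc X Y Z. apply downset_le_antisym.
  - apply lift_sub. intros S R [P [Q [HP [HQ HS]]]] HR.
    (* [S] is not itself a product but rewrites to [op P Q]; monotonicity performs this rewriting in
       context before reassociating. *)
    apply (members_down (steps_trans (Hmono _ _ _ _ HS (steps_refl R))
                                     (cong_steps (Hassoc P Q R)))).
    now repeat apply in_lift.
  - apply lift_sub. intros P S HP [Q [R [HQ [HR HS]]]].
    apply (members_down (steps_trans (Hmono _ _ _ _ (steps_refl P) HS)
                                     (cong_steps (cong_sym (Hassoc P Q R))))).
    now repeat apply in_lift.
Qed.

Lemma lift_unit_l op : steps_mono op -> (forall P, op One P ≡ P) ->
  forall X, lift op (principal One) X = X.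
Proof.
  intros Hmono Hunit X. apply downset_le_antisym.
  - apply lift_sub. intros P Q HP HQ.
    exact (members_down (steps_trans (Hmono _ _ _ _ HP (steps_refl Q))
                                     (cong_steps (Hunit Q))) HQ).
  - intros P HP. apply (members_down (cong_steps (cong_sym (Hunit P)))).
    apply in_lift; [apply steps_refl | exact HP].
Qed.

Lemma lift_unit_r op : steps_mono op -> (forall P, op P One ≡ P) ->
  forall X, lift op X (principal One) = X.
Proof.
  intros Hmono Hunit X. apply downset_le_antisym.
  - apply lift_sub. intros P Q HP HQ.
    exact (members_down (steps_trans (Hmono _ _ _ _ (steps_refl P) HQ)
                                     (cong_steps (Hunit P))) HP).
  - intros P HP. apply (members_down (cong_steps (cong_sym (Hunit P)))).
    apply in_lift; [exact HP | apply steps_refl].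
Qed.

Lemma lift_par_comm X Y : lift (@Par A) X Y = lift (@Par A) Y X.
Proof.
  apply downset_le_antisym; apply lift_sub; intros P Q HP HQ;
    apply (members_down (cong_steps (par_monoid_comm P Q))); now apply in_lift.
Qed.

(** * Frame inequalities from the rewrite rules *)

Lemma lift_sequence W X Y Z :
  downset_le (lift (@Par A) (lift (@Seq A) W X) (lift (@Seq A) Y Z))
             (lift (@Seq A) (lift (@Par A) W Y) (lift (@Par A) X Z)).
Proof.
  apply lift_sub. intros S T [P [Q [HP [HQ HS]]]] [P' [Q' [HP' [HQ' HT]]]].
  apply (members_down (steps_trans (steps_par HS HT)
                                   (step_steps (step_sequence P Q P' Q')))).
  now repeat apply in_lift.
Qed.

Lemma lift_external X Y Z :
  downset_le (lift (@Par A) (lift (@With A) X Y) Z)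
             (lift (@With A) (lift (@Par A) X Z) (lift (@Par A) Y Z)).
Proof.
  apply lift_sub. intros S R [P [Q [HP [HQ HS]]]] HR.
  apply (members_down (steps_trans (steps_par HS (steps_refl R))
                                   (step_steps (step_external P Q R)))).
  now repeat apply in_lift.
Qed.

Lemma lift_medial W X Y Z :
  downset_le (lift (@With A) (lift (@Seq A) W X) (lift (@Seq A) Y Z))
             (lift (@Seq A) (lift (@With A) W Y) (lift (@With A) X Z)).
Proof.
  apply lift_sub. intros S T [P [Q [HP [HQ HS]]]] [P' [Q' [HP' [HQ' HT]]]].
  apply (members_down (steps_trans (steps_with HS HT)
                                   (step_steps (step_medial P Q P' Q')))).
  now repeat apply in_lift.
Qed.

Lemma lift_tidy :
  downset_le (lift (@With A) (principal One) (principal One)) (principal One).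
Proof.
  apply lift_sub. intros P Q HP HQ.
  exact (steps_trans (steps_with HP HQ) (step_steps (@step_tidy A))).
Qed.

(** The four inequalities relating the operations and the unit are the rules sequence, external,
    medial and tidy, read on generators. *)
Definition syntactic_frame : mav_frame :=
  {| carrier := downset;
     fle := downset_le;
     fpar := lift (@Par A);
     fseq := lift (@Seq A);
     fi := principal One;
     fplus := lift (@With A);
     fle_order := downset_le_order;
     fpar_assoc := lift_assoc (@steps_par A) (@par_monoid_assoc A);
     fpar_comm := lift_par_comm;
     fpar_unit := lift_unit_l (@steps_par A) (@par_monoid_unit A);
     fpar_mono := @lift_mono (@Par A);
     fseq_assoc := lift_assoc (@steps_seq A) (@seq_monoid_assoc A);
     fseq_unit_l := lift_unit_l (@steps_seq A) (@seq_monoid_unit_l A);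
     fseq_unit_r := lift_unit_r (@steps_seq A) (@seq_monoid_unit_r A);
     fseq_mono := @lift_mono (@Seq A);
     fplus_mono := @lift_mono (@With A);
     fpar_fseq := lift_sequence;
     fpar_fplus := lift_external;
     fseq_fplus := lift_medial;
     fplus_fi := lift_tidy |}.

Local Notation F := syntactic_frame.

(** * Principal elements of the frame and the valuation of atoms *)

Lemma principal_le (P : structure A) (X : F) :
  In (members X) P -> (principal P : F) ≤ X.
Proof. intros H Q HQ. exact (members_down HQ H). Qed.

Lemma principal_lift op P Q :
  downset_le (principal (op P Q)) (lift op (principal P) (principal Q)).
Proof. apply (@principal_le _ (lift op _ _)), in_lift; apply steps_refl. Qed.

Lemma principal_in_alpha (X : Ensemble F) (P : structure A) :
  (principal P : F) ∈ X -> (principal P : F) ∈ alpha X.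
Proof.
  intros H. exists (principal P : F). split; [now apply comb_leaf | apply fle_refl].
Qed.

(** Passing through [alpha] gives closure under [+] by construction. *)
Definition closure (P : structure A) : closed_set F := alpha (eta (principal P : F)).

Lemma in_closure P : (principal P : F) ∈ closure P.
Proof. apply principal_in_alpha, fle_refl. Qed.

(** On generators this is the axiom rule at [CoAtom a], whose dual computes to [Atom a]. *)
Lemma atom_orth a : conv (closure (CoAtom a)) (closure (Atom a)) ⊆ K F.
Proof.
  apply conv_sub, alpha_par_alpha. intros X Y HX HY.
  apply (fle_trans (fpar_mono HX HY)). apply lift_sub. intros P Q HP HQ.
  exact (steps_trans (steps_par HP HQ) (step_steps (step_axiom (CoAtom a)))).
Qed.

Definition atom_valuation (a : A) : chu F :=
  {| pos := closure (CoAtom a); neg := closure (Atom a); chu_orth := @atom_orth a |}.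

Local Notation "⟦ P ⟧" := (interp atom_valuation P).

(** * Principal elements in the Chu operations *)

Lemma lift_in_closed op P Q (X : closed_set F) :
  (lift op (principal P) (principal Q) : F) ∈ X -> (principal (op P Q) : F) ∈ X.
Proof. apply closed_lower, principal_lift. Qed.

Lemma principal_conv P Q (X Y : closed_set F) :
  (principal P : F) ∈ X -> (principal Q : F) ∈ Y ->
  (principal (Par P Q) : F) ∈ conv X Y.
Proof.
  intros HP HQ. apply principal_in_alpha.
  exists (principal P), (principal Q). repeat split; [assumption .. | apply principal_lift].
Qed.

Lemma principal_hseq P Q (X Y : closed_set F) :
  (principal P : F) ∈ X -> (principal Q : F) ∈ Y ->
  (principal (Seq P Q) : F) ∈ hseq X Y.
Proof.
  intros HP HQ. exists (principal P), (principal Q).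
  repeat split; [assumption .. | apply principal_lift].
Qed.

(** The join is closed under [+], which is the lifted [With], so it contains the sum of the two
    principal elements. *)
Lemma principal_join P Q (X Y : closed_set F) :
  (principal P : F) ∈ X -> (principal Q : F) ∈ Y ->
  (principal (With P Q) : F) ∈ join X Y.
Proof.
  intros HP HQ. apply lift_in_closed. apply (@closed_plus F (join X Y)).
  - apply principal_in_alpha. now left.
  - apply principal_in_alpha. now right.
Qed.

(** [P ⊕ Q] rewrites to either summand, so its principal downset lies below both [principal P] and
    [principal Q]. *)
Lemma principal_meet P Q (X Y : closed_set F) :
  (principal P : F) ∈ X -> (principal Q : F) ∈ Y ->
  (principal (Plus P Q) : F) ∈ meet X Y.
Proof.
  intros HP HQ. split.
  - exact (closed_lower (principal_le (X := principal P) (step_steps (step_left P Q))) HP).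
  - exact (closed_lower (principal_le (X := principal Q) (step_steps (step_right P Q))) HQ).
Qed.

(** For [Z] in [Y'], orthogonality cancels [Z] against [Q], so switch puts the product of
    [principal (P ⊗ Q)] and [Z] below [principal P], an element of [X]. The other half is
    symmetric. *)
Lemma principal_tensor P Q (X X' Y Y' : closed_set F) :
  conv X X' ⊆ K F -> conv Y Y' ⊆ K F ->
  (principal P : F) ∈ X -> (principal Q : F) ∈ Y ->
  (principal (Tensor P Q) : F) ∈ meet (lolli Y' X) (lolli X' Y).
Proof.
  rewrite !conv_sub. intros HX HY HP HQ. split.
  - intros Z HZ. apply (@closed_lower F X _ (principal P)); [|exact HP].
    apply lift_sub. intros R S HR HS.
    apply (steps_trans (steps_par HR (steps_refl S))). apply steps_tensor_par.
    (* Orthogonality puts the product of [principal Q] and [Z] below the unit; as [S] lies in [Z],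
       this yields [Q ⅋ S ⟶* 𝟏]. *)
    apply (HY _ _ HQ HZ). apply in_lift; [apply steps_refl | exact HS].
  - intros Z HZ. apply (@closed_lower F Y _ (principal Q)); [|exact HQ].
    apply lift_sub. intros R S HR HS.
    apply (steps_trans (steps_par HR (steps_refl S))). apply steps_tensor_par_l.
    apply (HX _ _ HP HZ). apply in_lift; [apply steps_refl | exact HS].
Qed.

(** * Structures inside their own interpretation *)

Lemma principal_interp P :
  (principal P : F) ∈ neg ⟦P⟧ /\ (principal (dual P) : F) ∈ pos ⟦P⟧.
Proof.
  induction P as [a | a | | P [IHPn IHPp] Q [IHQn IHQp] | P [IHPn IHPp] Q [IHQn IHQp]
    | P [IHPn IHPp] Q [IHQn IHQp] | P [IHPn IHPp] Q [IHQn IHQp]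
    | P [IHPn IHPp] Q [IHQn IHQp]]; cbn [interp dual].
  - split; apply in_closure.
  - split; apply in_closure.
  - split; apply fle_refl.
  - split; now apply principal_hseq.
  - split; [|now apply principal_conv].
    (* Here [X] and [X'] are the negative and positive parts, so orthogonality is used with its
       sides exchanged; for par the roles are reversed. *)
    apply principal_tensor; trivial; apply chu_neg_orth.
  - split; [now apply principal_conv|].
    apply principal_tensor; trivial; apply chu_orth.
  - split; [now apply principal_join | now apply principal_meet].
  - split; [now apply principal_meet | now apply principal_join].
Qed.

End SyntacticFrame.

(** * From semantic validity to derivability *)

Theorem theorem4p3 (A : Type) (P : structure A) :
  (forall (F : mav_frame) (V : A -> chu F), chu_le (chu_I F) (interp V P)) ->
  steps P One.
Proof.
  intros H. destruct (H (syntactic_frame A) (@atom_valuation A)) as [_ Hneg].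
  (* Membership in [K] unfolds to inclusion of [principal P] in [principal One], which is evaluated
     at [P] itself. *)
  apply (Hneg _ (proj1 (principal_interp P))). apply steps_refl.
Qed.
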